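(* Let $\mathbf{A}\in\mathbb{R}^{m\times d}$, $\mathbf{b}\in\mathbb{R}^m$, $\mathbf{c}\in\mathbb{R}^d$, and let $\Omega:=\{x\in\mathbb{R}^d:\mathbf{A}x=\mathbf{b},\ x\geq0\}$. Assume that $\Omega$ is compact and that there exists $x_0\in\Omega$ with $x_0>0$ (componentwise). For every $\varepsilon>0$, let $x^*(\varepsilon)$ be the unique minimizer of $$\min_{x}\Big\{\,\mathbf{c}^Tx+\varepsilon\sum_{i=1}^d x_i\ln(x_i):\ \mathbf{A}x=\mathbf{b},\ x\geq0\,\Big\}.$$ Then, as $\varepsilon\downarrow0$, $x^*(\varepsilon)$ converges to $x^*$, the unique minimizer of the linear program $\min\{\mathbf{c}^Tx:\mathbf{A}x=\mathbf{b},\ x\geq0\}$ which minimizes the Shannon entropy $\sum_{i=1}^d x_i\ln(x_i)$ among all minimizers of this linear program.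
   Context: The convention $0\ln(0)=0$ is used throughout. *)

(* Defs.v *)
From mathcomp Require Import all_boot all_order all_algebra.
From mathcomp Require Import all_classical all_reals all_analysis.

Set Implicit Arguments.
Unset Strict Implicit.
Unset Printing Implicit Defensive.

Import Order.TTheory GRing.Theory Num.Theory numFieldNormedType.Exports.

Local Open Scope classical_set_scope.
Local Open Scope ring_scope.

Definition minimizers (R : realType) (T : Type) (f : T -> R) (S : set T) :
    set T :=
  [set x | S x /\ forall y, S y -> f x <= f y].

Definition feasible (R : realType) (m d : nat) (A : 'M[R]_(m, d))
    (b : 'cV[R]_m) : set 'cV[R]_d :=
  [set x | A *m x = b /\ forall i, 0 <= x i 0].

Definition linear_cost (R : realType) (d : nat) (c x : 'cV[R]_d) : R :=
  (c^T *m x) 0 0.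

(* The convention 0 ln(0) = 0 holds automatically: [ln] is total, so the
   product with 0 vanishes.  No minus sign is used in this entropy. *)
Definition entropy (R : realType) (d : nat) (x : 'cV[R]_d) : R :=
  \sum_(i < d) x i 0 * ln (x i 0).

Definition regularized_cost (R : realType) (d : nat) (c : 'cV[R]_d) (eps : R)
    (x : 'cV[R]_d) : R :=
  linear_cost c x + eps * entropy x.

(* Main.v *)
(* Compactness of the feasible set gives the minimizers, strict convexity of the
   entropy H their uniqueness.  Comparing costs at x(eps) and at the limit point
   xs shows that H(x(eps)) <= H(xs) and
   c^T x(eps) <= c^T xs + eps (H(xs) - min H).  Outside an open neighbourhood of
   xs, the feasible points with H <= H(xs) form a compact set containing no
   solution of the linear program; the cost there exceeds c^T xs by a positive
   gap, which x(eps) cannot reach for small eps. *)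

Require Import Defs.
From mathcomp Require Import all_boot all_order all_algebra.
From mathcomp Require Import all_classical all_reals all_analysis.
From mathcomp Require Import ring lra.

Set Implicit Arguments.
Unset Strict Implicit.
Unset Printing Implicit Defensive.

Import Order.TTheory GRing.Theory Num.Theory numFieldNormedType.Exports.

Local Open Scope classical_set_scope.
Local Open Scope ring_scope.

(** The graph of [t * ln t] lies strictly above its tangent at [s]. For [t > 0] this is
    [1 + u < expR u] at [u = ln (s / t)], multiplied by [t]; at [t = 0] it reads [- s < 0]. *)
Lemma tangent_xlnx_lt (R : realType) (s t : R) :
  0 < s -> 0 <= t -> t != s -> t * ln s + t - s < t * ln t.
Proof.
move=> s0; rewrite le_eqVlt => /orP[/eqP <- _|t0 ts].
  by rewrite !mul0r !add0r oppr_lt0.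
have st0 : 0 < s / t by rewrite divr_gt0.
have : 1 + ln (s / t) < expR (ln (s / t)).
  apply: expR_gt1Dx; rewrite ln_eq0//.
  by apply: contra ts => /eqP e; rewrite -(divfK (lt0r_neq0 t0) s) e mul1r.
rewrite lnK ?posrE// ln_div ?posrE// ltr_pdivlMr//; lra.
Qed.

(** Add the tangent inequalities at the midpoint [s] for [x] and [y]: the affine terms cancel
    because [x + y = 2 * s]. Two distinct nonnegative numbers make [s] positive, so the endpoint 0
    needs no derivative. *)
Lemma midpoint_xlnx_lt (R : realType) (x y : R) : 0 <= x -> 0 <= y -> x != y ->
  (2^-1 * (x + y)) * ln (2^-1 * (x + y)) < 2^-1 * (x * ln x + y * ln y).
Proof.
move=> x0 y0 xy; set s := 2^-1 * (x + y).
have sE : x + y = 2 * s by rewrite /s; field.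
have s0 : 0 < s by move/eqP: xy => xy; rewrite /s; lra.
have xs : x != s by apply: contra xy => /eqP e; apply/eqP; lra.
have ys : y != s by apply: contra xy => /eqP e; apply/eqP; lra.
have := tangent_xlnx_lt s0 x0 xs; have := tangent_xlnx_lt s0 y0 ys.
have : x * ln s + y * ln s = 2 * (s * ln s) by rewrite -mulrDl sE mulrA.
lra.
Qed.

(** A lower bound that tends to 0 with [t], for the squeeze at 0. With [t = u ^ 2], it is
    [ln u^-1 < u^-1] multiplied by [2 * u ^ 2]. *)
Lemma xlnx_ge (R : realType) (t : R) : - (2 * Num.sqrt t) <= t * ln t.
Proof.
have [t0|t0] := leP t 0.
  by rewrite ln0// mulr0 oppr_le0 mulr_ge0// sqrtr_ge0.
have u0 : 0 < Num.sqrt t by rewrite sqrtr_gt0.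
rewrite -{2 3}(sqr_sqrtr (ltW t0)); move: (Num.sqrt t) u0 => u u0.
have /ln_sublinear : 0 < u^-1 by rewrite invr_gt0.
rewrite lnV ?posrE// lnXn// -(ltr_pM2l (exprn_gt0 2 u0)) expr2.
by rewrite mulfK ?gt_eqF//; lra.
Qed.

(* On the negative half-line the function vanishes, [ln] being 0 there. *)
Lemma continuous_xlnx (R : realType) : continuous (fun t : R => t * ln t).
Proof.
move=> t; have [t0|t0|->] := ltgtP t 0.
- apply: (@near_cst_continuous _ _ 0); near=> x.
  by rewrite ln0 ?mulr0//; apply: ltW; near: x; exact: lt_nbhsl.
- by apply: cvgM; [exact: cvg_id|exact: continuous_ln].
rewrite /continuous_at mul0r.
apply: (@squeeze_cvgr _ _ _ _ (fun x : R => - (2 * Num.sqrt x)) (cst 0)).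
- near=> x; rewrite xlnx_ge/=.
  have [x0|x0] := leP x 0; first by rewrite ln0// mulr0.
  rewrite mulr_ge0_le0 ?(ltW x0)//; apply: ln_le0.
  by apply: ltW; near: x; exact: lt_nbhsl.
(* The limit 0 is written as the value of the lower bound at 0, the form that the limit rules
   produce. *)
- have -> : nbhs (0 : R) = nbhs (- (2 * Num.sqrt (0 : R))).
    by rewrite sqrtr0 mulr0 oppr0.
  by apply: cvgN; apply: cvgM; [exact: cvg_cst|exact: sqrt_continuous].
- exact: cvg_cst.
Unshelve. all: by end_near. Qed.

Lemma continuous_sum_coord (R : realType) (d : nat) (g : 'I_d -> R -> R) :
  (forall i, continuous (g i)) ->
  continuous (fun x : 'cV[R]_d => \sum_(i < d) g i (x i 0)).
Proof.
move=> gc x; apply: (@cvg_big _ _ +%R); first exact: add_continuous.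
  exact: nbhs_filter.
move=> i _; apply: (@continuous_comp _ _ _ (fun x : 'cV[R]_d => x i 0)).
  exact: coord_continuous.
exact: gc.
Qed.

Lemma continuous_entropy (R : realType) (d : nat) : continuous (@entropy R d).
Proof.
apply: (@continuous_sum_coord _ _ (fun _ t => t * ln t)) => i.
exact: continuous_xlnx.
Qed.

Lemma linear_costE (R : realType) (d : nat) (c x : 'cV[R]_d) :
  linear_cost c x = \sum_(i < d) c i 0 * x i 0.
Proof. by rewrite /linear_cost mxE; apply: eq_bigr => i _; rewrite mxE. Qed.

Lemma continuous_linear_cost (R : realType) (d : nat) (c : 'cV[R]_d) :
  continuous (linear_cost c).
Proof.
under [linear_cost c]funext do rewrite linear_costE.
apply: (@continuous_sum_coord _ _ (fun i => *%R (c i 0))) => i.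
exact: mulrl_continuous.
Qed.

Lemma continuous_regularized_cost (R : realType) (d : nat) (c : 'cV[R]_d)
  (eps : R) : continuous (regularized_cost c eps).
Proof.
move=> x.
apply: (@cvgD _ _ _ _ _ (linear_cost c) (fun y => eps * entropy y)).
- exact: nbhs_filter.
- exact: continuous_linear_cost.
- apply: (@cvgM _ _ _ _ (cst eps) (@entropy R d)).
  + exact: nbhs_filter.
  + exact: cst_continuous.
  + exact: continuous_entropy.
Qed.

Lemma linear_cost_midpoint (R : realType) (d : nat) (c x y : 'cV[R]_d) :
  linear_cost c (2^-1 *: (x + y)) =
  2^-1 * (linear_cost c x + linear_cost c y).
Proof. by rewrite /linear_cost -scalemxAr mulmxDr !mxE. Qed.

Lemma feasible_midpoint (R : realType) (m d : nat) (A : 'M[R]_(m, d))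
    (b : 'cV[R]_m) (x y : 'cV[R]_d) :
  feasible A b x -> feasible A b y -> feasible A b (2^-1 *: (x + y)).
Proof.
move=> [Ax x0] [Ay y0]; split.
  rewrite -scalemxAr mulmxDr Ax Ay -mulr2n -(scaler_nat 2 b)
    scalerA mulVf ?pnatr_eq0 ?scale1r//.
by move=> i; rewrite !mxE mulr_ge0 ?addr_ge0// invr_ge0.
Qed.

(** Distinct vectors differ in some coordinate [i], which gives the strict inequality; each other
    coordinate contributes a weak one. *)
Lemma entropy_midpoint_lt (R : realType) (m d : nat) (A : 'M[R]_(m, d))
    (b : 'cV[R]_m) (x y : 'cV[R]_d) :
  feasible A b x -> feasible A b y -> x <> y ->
  entropy (2^-1 *: (x + y)) < 2^-1 * (entropy x + entropy y).
Proof.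
move=> [_ x0] [_ y0] xy.
have [i xyi] : exists i, x i 0 != y i 0.
  apply/existsP; apply: contra_notT xy => /existsPn h.
  by apply/matrixP => i j; rewrite ord1; apply/eqP; rewrite -[_ == _]negbK.
rewrite /entropy -big_split/= mulr_sumr (bigD1 i)//= [ltRHS](bigD1 i)//=.
rewrite !mxE ltr_leD//; first exact: midpoint_xlnx_lt.
apply: ler_sum => j _; rewrite !mxE.
have [->|xyj] := eqVneq (x j 0) (y j 0); last exact/ltW/midpoint_xlnx_lt.
have mid (t : R) : 2^-1 * (t + t) = t by field.
by rewrite !mid.
Qed.

Lemma minimizers_compact_nonempty (T : topologicalType) (R : realType)
    (f : T -> R) (S : set T) :
  continuous f -> compact S -> S !=set0 -> minimizers f S !=set0.
Proof.
move=> fc Sc S0.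
have [x Sx xmin] := compact_EVT_min S0 Sc (continuous_subspaceT fc).
exists x; split; first exact: set_mem.
by move=> y Sy; apply: xmin; exact: mem_set.
Qed.

Lemma compact_sublevel (T : topologicalType) (R : realType)
    (f : T -> R) (S : set T) (v : R) :
  continuous f -> compact S -> compact (S `&` [set x | f x <= v]).
Proof.
move=> fc Sc; apply: compact_closedI => //.
by apply: (preimage_closed _ (@closed_le R v)) => x _; exact: fc.
Qed.

(** When nonempty, the set of minimizers is the sublevel set at the minimal value. This makes the
    solution set of the linear program compact, so that the entropy attains a minimum on it. *)
Lemma compact_minimizers (T : topologicalType) (R : realType)
    (f : T -> R) (S : set T) :
  continuous f -> compact S -> compact (minimizers f S).
Proof.
move=> fc Sc; have [->|/set0P[x [Sx xmin]]] := eqVneq (minimizers f S) set0.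
  exact: compact0.
suff -> : minimizers f S = S `&` [set y | f y <= f x] by
  exact: compact_sublevel.
apply/seteqP; split=> y [Sy fy]; split=> //=; first exact: fy.
by move=> z /xmin; exact: le_trans.
Qed.

(** The midpoint of two distinct minimizers would have a strictly smaller value. The lemma serves
    both the regularized problem and the entropy on the solution set of the linear program. *)
Lemma unique_minimizer (R : realType) (d : nat) (f : 'cV[R]_d -> R)
    (S : set 'cV[R]_d) :
  continuous f -> compact S -> S !=set0 ->
  (forall x y, S x -> S y -> S (2^-1 *: (x + y))) ->
  (forall x y, S x -> S y -> x <> y ->
     f (2^-1 *: (x + y)) < 2^-1 * (f x + f y)) ->
  exists! x, minimizers f S x.
Proof.
move=> fc Sc S0 Smid fmid.
have [x [Sx xmin]] := minimizers_compact_nonempty fc Sc S0.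
exists x; split => // y [Sy ymin]; apply: contrapT => xy.
have := fmid x y Sx Sy xy; have := xmin _ Sy; have := ymin _ Sx.
by have := xmin _ (Smid _ _ Sx Sy); lra.
Qed.

Theorem lemma3p1 (R : realType) (m d : nat) (A : 'M[R]_(m, d))
    (b : 'cV[R]_m) (c : 'cV[R]_d)
    (Omega_compact : compact (feasible A b))
    (Omega_pos : exists x0 : 'cV[R]_d,
        feasible A b x0 /\ forall i : 'I_d, 0 < x0 i 0) :
  (forall eps : R, 0 < eps ->
     exists! x : 'cV[R]_d,
       minimizers (regularized_cost c eps) (feasible A b) x) /\
  (exists! x : 'cV[R]_d,
     minimizers (@entropy R d) (minimizers (linear_cost c) (feasible A b)) x) /\
  (forall (xeps : R -> 'cV[R]_d) (xstar : 'cV[R]_d),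
     (forall eps : R, 0 < eps ->
        minimizers (regularized_cost c eps) (feasible A b) (xeps eps)) ->
     minimizers (@entropy R d) (minimizers (linear_cost c) (feasible A b)) xstar ->
     xeps eps @[eps --> 0^'+] --> xstar).
Proof.
have Omega0 : feasible A b !=set0 by have [x0 [? _]] := Omega_pos; exists x0.
have uniqS : exists! x : 'cV[R]_d,
    minimizers (@entropy R d) (minimizers (linear_cost c) (feasible A b)) x.
  apply: unique_minimizer.
  - exact: continuous_entropy.
  - by apply: compact_minimizers => //; exact: continuous_linear_cost.
  - apply: minimizers_compact_nonempty => //; exact: continuous_linear_cost.
  - move=> x y [Ox xmin] [Oy ymin]; split; first exact: feasible_midpoint.
    move=> z Oz; rewrite linear_cost_midpoint.
    by have := xmin z Oz; have := ymin z Oz; lra.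
  - by move=> x y [Ox _] [Oy _]; exact: entropy_midpoint_lt Ox Oy.
split; [|split=> //].
  move=> eps eps0; apply: unique_minimizer => //.
  - exact: continuous_regularized_cost.
  - by move=> x y; exact: feasible_midpoint.
  - move=> x y Ox Oy xy; rewrite /regularized_cost linear_cost_midpoint.
    have := entropy_midpoint_lt Ox Oy xy; rewrite -(ltr_pM2l eps0); lra.
move=> xeps xstar xepsP xstarP.
have [[Ostar starmin] Hstar] := xstarP.
have [z [Oz zmin]] :=
  minimizers_compact_nonempty (@continuous_entropy R d) Omega_compact Omega0.
(* The linear cost of [xeps eps] is at least that of [xstar], so optimality for the regularized cost
   must come from the entropy term. *)
have Heps (eps : R) : 0 < eps -> entropy (xeps eps) <= entropy xstar.
  move=> eps0; have [Oe /(_ _ Ostar) opt] := xepsP _ eps0.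
  rewrite -(ler_pM2l eps0); move: opt (starmin _ Oe).
  by rewrite /regularized_cost; lra.
have Ceps (eps : R) : 0 < eps -> linear_cost c (xeps eps) <=
    linear_cost c xstar + eps * (entropy xstar - entropy z).
  move=> eps0; have [Oe /(_ _ Ostar) opt] := xepsP _ eps0.
  move: opt (ler_wpM2l (ltW eps0) (zmin _ Oe)).
  by rewrite /regularized_cost; lra.
move=> V; rewrite nbhsE => -[U [oU Ustar] UV].
suff : \forall eps \near (0 : R)^'+, U (xeps eps).
  by apply: filterS => eps; exact: UV.
pose K := feasible A b `&` [set x | entropy x <= entropy xstar] `&` ~` U.
have Kc : compact K.
  apply: compact_closedI; last exact: open_closedC.
  by apply: compact_sublevel => //; exact: continuous_entropy.
have epsK (eps : R) : 0 < eps -> ~ K (xeps eps) -> U (xeps eps).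
  move=> eps0 nK; apply: contrapT => nU; apply: nK.
  by split => //; split; [exact: (xepsP _ eps0).1|exact: Heps].
have [K0|/set0P K0] := eqVneq K set0.
  near=> eps; apply: epsK; last by rewrite K0.
  by near: eps; exact: nbhs_right_gt.
have [y [[[Oy Hy] nUy] ymin]] :=
  minimizers_compact_nonempty (@continuous_linear_cost R d c) Kc K0.
(* Otherwise [y] would solve the linear program with entropy at most that of [xstar], hence equal
   [xstar] by uniqueness and lie in [U]. *)
have cy : linear_cost c xstar < linear_cost c y.
  rewrite ltNge; apply/negP => cy; apply: nUy.
  have [w [_ wuniq]] := uniqS.
  rewrite -(wuniq y) ?(wuniq xstar)//; split.
    by split=> // u Ou; exact: le_trans cy (starmin _ Ou).
  by move=> u Lu; exact: le_trans Hy (Hstar _ Lu).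
have M0 : 0 <= entropy xstar - entropy z by rewrite subr_ge0 zmin.
(* The cost gap divided by the coefficient of [eps] in [Ceps]; the added 1 keeps the denominator
   positive when [xstar] already minimizes the entropy over the whole feasible set. *)
pose delta := (linear_cost c y - linear_cost c xstar) /
  (entropy xstar - entropy z + 1).
have M1 : 0 < entropy xstar - entropy z + 1 by rewrite ltr_wpDl.
have delta0 : 0 < delta by rewrite divr_gt0 ?subr_gt0.
near=> eps.
have eps0 : 0 < eps by near: eps; exact: nbhs_right_gt.
apply: epsK => // /ymin; apply/negP; rewrite -ltNge.
apply: le_lt_trans (Ceps _ eps0) _.
have : eps < delta by near: eps; exact: nbhs_right_lt.
by rewrite /delta ltr_pdivlMr//; lra.
Unshelve. all: by end_near. Qed.
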